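(* Let $({}_{f_2}M_1\times{}_{f_1}M_2,F)$ be a proper doubly warped product Finsler manifold (i.e. neither $f_1$ nor $f_2$ is constant) whose Berwald curvature vanishes. Then $({}_{f_2}M_1\times{}_{f_1}M_2,F)$ is a Riemannian manifold.
   Context: A Finsler metric on a manifold $M$ is a function $F:TM\to[0,\infty)$ that is $C^\infty$ on the slit tangent bundle $TM^\circ$, positively $1$-homogeneous on fibres, and whose fibre Hessian of $\frac12F^2$ is positive definite. Let $(M_1,F_1)$, $(M_2,F_2)$ be Finsler manifolds and let $f_1:M_1\to\mathbb{R}^+$, $f_2:M_2\to\mathbb{R}^+$ be smooth (the warping functions). The doubly warped product Finsler manifold $({}_{f_2}M_1\times{}_{f_1}M_2,F)$ is $M=M_1\times M_2$ with $$F(v_1,v_2)=\sqrt{f_2^2(\pi_2(v_2))F_1^2(v_1)+f_1^2(\pi_1(v_1))F_2^2(v_2)},\qquad (v_1,v_2)\in TM^\circ:=TM_1^\circ\times TM_2^\circ,$$ where $\pi_1,\pi_2$ are the base-point projections; all objects are considered on $TM^\circ$. In induced coordinates $(\mathbf{x}^a,\mathbf{y}^a)$ on $TM$, put $\mathbf{g}_{ab}=\frac12\frac{\partial^2F^2}{\partial\mathbf{y}^a\partial\mathbf{y}^b}$, with inverse $\mathbf g^{ab}$, and spray coefficients $\mathbf{G}^a=\frac14\mathbf{g}^{ab}\big(\frac{\partial^2F^2}{\partial\mathbf{y}^b\partial\mathbf{x}^c}\mathbf{y}^c-\frac{\partial F^2}{\partial\mathbf{x}^b}\big)$. The Berwald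 curvature is $\mathbf{B}^d_{abc}=\frac{\partial^3\mathbf{G}^d}{\partial\mathbf{y}^a\partial\mathbf{y}^b\partial\mathbf{y}^c}$. A Finsler metric is Riemannian if and only if its Cartan tensor $\frac12\frac{\partial \mathbf{g}_{ab}}{\partial\mathbf{y}^c}$ vanishes.
   Formalization: The manifolds M_1 and M_2 are assumed connected; otherwise a warping function could be locally constant without being constant, and the claim fails (e.g. disjoint copies of non-Riemannian Minkowski spaces). *)

(* Defs.v *)
From HB Require Import structures.
From mathcomp Require Import all_boot all_order all_algebra.
From mathcomp Require Import all_classical all_reals all_analysis.
Set Implicit Arguments.
Unset Strict Implicit.
Unset Printing Implicit Defensive.
Import Order.TTheory GRing.Theory Num.Theory.
Import numFieldNormedType.Exports.
Local Open Scope classical_set_scope.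
Local Open Scope ring_scope.

Fixpoint iter_derive (R : realType) (V W : normedModType R)
    (vs : seq V) (f : V -> W) : V -> W :=
  if vs is v :: vs' then fun x => 'D_v (iter_derive vs' f) x else f.

(* C^oo on an open set U: every iterated directional derivative exists and is
   (Frechet) differentiable at every point of U. *)
Definition smooth_on (R : realType) (V W : normedModType R)
    (U : set V) (f : V -> W) : Prop :=
  forall (vs : seq V) (x : V), U x -> differentiable (iter_derive vs f) x.

(* Manifolds are connected, Hausdorff and second countable. The maps chart_map
   and chart_inv are total; they are meaningful only on chart_dom i and on its
   image. The preferred chart chart_at p around each point p is an arbitrary
   choice, used only to represent tangent vectors (see tangent). *)
Record smooth_manifold (R : realType) (n : nat) : Type := SmoothManifold {
  carrier :> topologicalType ;
  chart_index : Type ;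
  chart_dom : chart_index -> set carrier ;
  chart_map : chart_index -> carrier -> 'rV[R]_n ;
  chart_inv : chart_index -> 'rV[R]_n -> carrier ;
  chart_at : carrier -> chart_index ;
  manifold_hausdorff : hausdorff_space carrier ;
  manifold_second_countable : @second_countable carrier ;
  manifold_connected : connected [set: carrier] ;
  chart_dom_open : forall i, open (chart_dom i) ;
  chart_codom_open : forall i, open (chart_map i @` chart_dom i) ;
  chart_mapK : forall i p, chart_dom i p -> chart_inv i (chart_map i p) = p ;
  chart_map_continuous : forall i p, chart_dom i p ->
    {for p, continuous (chart_map i)} ;
  chart_inv_continuous : forall i x, (chart_map i @` chart_dom i) x ->
    {for x, continuous (chart_inv i)} ;
  chart_at_dom : forall p, chart_dom (chart_at p) p ;
  transition_smooth : forall i j,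
    smooth_on (chart_map i @` (chart_dom i `&` chart_dom j))
              (chart_map j \o chart_inv i) }.

Definition chart_codom (R : realType) (n : nat) (M : smooth_manifold R n)
    (i : chart_index M) : set 'rV[R]_n :=
  chart_map i @` chart_dom i.

(* A tangent vector is a pair (p, w) of its base point p and of its components w
   in the preferred chart chart_at p. *)
Definition tangent (R : realType) (n : nat) (M : smooth_manifold R n) : Type :=
  (M * 'rV[R]_n)%type.

(* The tangent vector with induced coordinates (x, y) in the chart i; its
   components in the preferred chart at p are obtained by applying to y the
   differential at x of the change of coordinates. *)
Definition tangent_of_coord (R : realType) (n : nat) (M : smooth_manifold R n)
    (i : chart_index M) (x y : 'rV[R]_n) : tangent M :=
  let p := chart_inv i x in
  (p, 'd (chart_map (chart_at p) \o chart_inv i) x y).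

Definition smooth_function (R : realType) (n : nat) (M : smooth_manifold R n)
    (f : M -> R) : Prop :=
  forall i : chart_index M, smooth_on (chart_codom i) (f \o chart_inv i).

Definition constant_function (T : Type) (R : Type) (f : T -> R) : Prop :=
  exists c : R, forall p : T, f p = c.

Section LocalExpressions.
Variables (R : realType) (n : nat).
Implicit Types (x y : 'rV[R]_n) (L F : 'rV[R]_n -> 'rV[R]_n -> R).

Definition dx (a : 'I_n) L : 'rV[R]_n -> 'rV[R]_n -> R :=
  fun x y => 'D_(delta_mx 0 a) (fun x' => L x' y) x.

Definition dy (a : 'I_n) L : 'rV[R]_n -> 'rV[R]_n -> R :=
  fun x y => 'D_(delta_mx 0 a) (L x) y.

Definition sqr_metric F : 'rV[R]_n -> 'rV[R]_n -> R :=
  fun x y => F x y ^+ 2.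

Definition metric_tensor F x y : 'M[R]_n :=
  \matrix_(a, b) (2^-1 * dy a (dy b (sqr_metric F)) x y).

Definition spray_coef F (a : 'I_n) x y : R :=
  4^-1 * \sum_(b < n) invmx (metric_tensor F x y) a b *
    (\sum_(c < n) dy b (dx c (sqr_metric F)) x y * y 0 c
     - dx b (sqr_metric F) x y).

(* B^d_abc: the upper index comes last. *)
Definition berwald_curvature F (a b c d : 'I_n) x y : R :=
  dy a (dy b (dy c (spray_coef F d))) x y.

Definition cartan_tensor F (a b c : 'I_n) x y : R :=
  2^-1 * dy c (fun x' y' => metric_tensor F x' y' a b) x y.

End LocalExpressions.

Definition local_expr (R : realType) (n : nat) (M : smooth_manifold R n)
    (F : tangent M -> R) (i : chart_index M) (x y : 'rV[R]_n) : R :=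
  F (tangent_of_coord i x y).

(* Over a chart i the slit tangent bundle is {(x, y) | chart_codom i x, y != 0}:
   the differentials of the changes of coordinates are invertible. *)
Record finsler_metric (R : realType) (n : nat) (M : smooth_manifold R n)
    (F : tangent M -> R) : Prop := FinslerMetric {
  finsler_ge0 : forall v, 0 <= F v ;
  finsler_smooth : forall i : chart_index M,
    smooth_on [set z : 'rV[R]_n * 'rV[R]_n | chart_codom i z.1 /\ z.2 != 0]
              (fun z => local_expr F i z.1 z.2) ;
  finsler_homogeneous : forall (v : tangent M) (c : R), 0 < c ->
    F (v.1, c *: v.2) = c * F v ;
  finsler_posdef : forall (i : chart_index M) (x y : 'rV[R]_n),
    chart_codom i x -> y != 0 -> forall u : 'rV[R]_n, u != 0 ->
    0 < \sum_(a < n) \sum_(b < n)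
          metric_tensor (local_expr F i) x y a b * u 0 a * u 0 b }.

Section Product.
Variables (R : realType) (n1 n2 : nat).
Variables (M1 : smooth_manifold R n1) (M2 : smooth_manifold R n2).

(* v.1 is the base point of the tangent vector v. *)
Definition doubly_warped_product (F1 : tangent M1 -> R) (F2 : tangent M2 -> R)
    (f1 : M1 -> R) (f2 : M2 -> R) (v1 : tangent M1) (v2 : tangent M2) : R :=
  Num.sqrt (f2 v2.1 ^+ 2 * F1 v1 ^+ 2 + f1 v1.1 ^+ 2 * F2 v2 ^+ 2).

(* Functions on T(M1 x M2) = TM1 x TM2 are expressed in the coordinates induced
   by a product chart (i1, i2): the first n1 entries of x and y are the
   coordinates of the TM1 component, the last n2 those of the TM2 component. *)
Definition prod_local_expr (F : tangent M1 -> tangent M2 -> R)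
    (i1 : chart_index M1) (i2 : chart_index M2) (x y : 'rV[R]_(n1 + n2)) : R :=
  F (tangent_of_coord i1 (lsubmx x) (lsubmx y))
    (tangent_of_coord i2 (rsubmx x) (rsubmx y)).

(* The part of TM1° x TM2° over the product chart (i1, i2), in coordinates;
   both components of the tangent vector are nonzero. *)
Definition prod_slit_coord (i1 : chart_index M1) (i2 : chart_index M2)
    (x y : 'rV[R]_(n1 + n2)) : Prop :=
  [/\ chart_codom i1 (lsubmx x), chart_codom i2 (rsubmx x),
      lsubmx y != 0 & rsubmx y != 0].

Definition berwald_vanishes (F : tangent M1 -> tangent M2 -> R) : Prop :=
  forall i1 i2 x y, prod_slit_coord i1 i2 x y ->
  forall a b c d, berwald_curvature (prod_local_expr F i1 i2) a b c d x y = 0.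

(* Being Riemannian means vanishing of the Cartan tensor on TM1° x TM2°. This is
   weaker than F^2 being quadratic on whole fibres when a factor has dimension
   1, since its slit tangent spaces are then disconnected and F may be
   non-reversible there. *)
Definition riemannian (F : tangent M1 -> tangent M2 -> R) : Prop :=
  forall i1 i2 x y, prod_slit_coord i1 i2 x y ->
  forall a b c, cartan_tensor (prod_local_expr F i1 i2) a b c x y = 0.

End Product.

(* Main.v *)
Require Import Defs.
From HB Require Import structures.
From mathcomp Require Import all_boot all_order all_algebra.
From mathcomp Require Import all_classical all_reals all_analysis.
From mathcomp Require Import ring.
Set Implicit Arguments.
Unset Strict Implicit.
Unset Printing Implicit Defensive.
Import Order.TTheory GRing.Theory Num.Theory.
Import numFieldNormedType.Exports.
Local Open Scope classical_set_scope.
Local Open Scope ring_scope.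

(* With w_k = f_k^2, the energy is F^2 = w_2(u) F_1^2(x, y) + w_1(x) F_2^2(u, v)
   and its metric tensor is block diagonal. Hence, as a function of v alone, the
   spray coefficient G^i in a direction i of M_1 is affine in v up to the term
   - 1/4 (w_2 g_1)^{ij} (d w_1 / d x^j) F_2^2(u, v).
   Its third v-derivatives are Berwald curvature components, so at a point x where
   d w_1 <> 0, which exists because M_1 is connected and f_1 is not constant, the
   third v-derivatives of F_2^2 vanish for every (u, v). Exchanging the factors
   gives the same for F_1^2, and these are the only third derivatives of F^2 that
   enter the Cartan tensor. *)

(** * Directional derivatives, and products of smooth functions *)

Section Derivatives.
Context {R : realType}.
Implicit Types V W : normedModType R.

(** The two difference quotients are the same function of [h]. The maps [phi] used below are pairing
    with a fixed point, projection of a row to a block, juxtaposition with a fixed block, a linear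
    form, and the parametrisation of a segment. *)
Lemma derivable_affine {V V' W} {phi : V -> V'} {x v w} :
  (forall h, phi (h *: v + x) = h *: w + phi x) ->
  forall f : V' -> W,
  derivable (fun z => f (phi z)) x v <-> derivable f (phi x) w.
Proof.
move=> phiE f; rewrite /derivable.
suff -> : (fun h : R => h^-1 *: (((fun z => f (phi z)) \o shift x) (h *: v)
   - f (phi x))) = (fun h => h^-1 *: ((f \o shift (phi x)) (h *: w) - f (phi x))).
  by [].
by apply/funext => h /=; rewrite phiE.
Qed.

Lemma derive_affine {V V' W} {phi : V -> V'} {x v w} :
  (forall h, phi (h *: v + x) = h *: w + phi x) ->
  forall f : V' -> W, 'D_v (fun z => f (phi z)) x = 'D_w f (phi x).
Proof.
move=> phiE f; rewrite /derive.
suff -> : (fun h : R => h^-1 *: (((fun z => f (phi z)) \o shift x) (h *: v)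
   - f (phi x))) = (fun h => h^-1 *: ((f \o shift (phi x)) (h *: w) - f (phi x))).
  by [].
by apply/funext => h /=; rewrite phiE.
Qed.

Lemma is_derive_affine {V V' W} {phi : V -> V'} {x v w} :
  (forall h, phi (h *: v + x) = h *: w + phi x) ->
  forall f : V' -> W, derivable f (phi x) w ->
  is_derive x v (fun z => f (phi z)) ('D_w f (phi x)).
Proof.
move=> phiE f df; rewrite -(derive_affine phiE); apply: derivableP.
exact/(derivable_affine phiE).
Qed.

Lemma is_derive_lincomb {V} (k1 k2 : R) {f1 f2 : V -> R} {x v d1 d2} :
  is_derive x v f1 d1 -> is_derive x v f2 d2 ->
  is_derive x v (fun z => k1 * f1 z + k2 * f2 z) (k1 * d1 + k2 * d2).
Proof.
move=> D1 D2.
exact: (is_derive_eq (is_deriveD (is_deriveZ k1 D1) (is_deriveZ k2 D2))).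
Qed.

Lemma is_derive_mul {V} {f1 f2 : V -> R} {x v d1 d2} :
  is_derive x v f1 d1 -> is_derive x v f2 d2 ->
  is_derive x v (fun z => f1 z * f2 z) (f1 x * d2 + d1 * f2 x).
Proof.
by move=> D1 D2; apply: (is_derive_eq (is_deriveM D1 D2)); rewrite (mulrC d1).
Qed.

Lemma open_eq_derive {V W} {U : set V} {f g : V -> W} {x} v : open U ->
  (forall z, U z -> f z = g z) -> U x -> 'D_v f x = 'D_v g x.
Proof.
by move=> Uo fg Ux; apply/near_eq_derive/(filterS fg)/open_nbhs_nbhs.
Qed.

(** As [f] and [g] agree near [x], the differential of [f] also gives the first-order expansion of
    [g]; by uniqueness it is the differential of [g]. *)
Lemma open_eq_differentiable {V W} {U : set V} {f g : V -> W} {x} : open U ->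
  (forall z, U z -> f z = g z) -> U x -> differentiable f x -> differentiable g x.
Proof.
move=> Uo fg Ux df.
have dfg : g \o shift x = cst (g x) + 'd f x +o_ 0 id.
  apply/eqaddoP => e e0; have /eqaddoP/(_ e e0) := diff_locally df.
  have: \forall h \near 0, U (h + x).
    have /= := @near_shift _ _ 0 x U; rewrite subr0 => <-.
    exact: open_nbhs_nbhs.
  apply: filterS2 => h Uh; rewrite !fctE /= -(fg _ Uh) -(fg _ Ux).
  exact.
have cf := diff_continuous df.
by apply/diff_locallyP; rewrite (diff_unique cf dfg).
Qed.

(** The head of the list is differentiated last, so the innermost derivative is peeled off at the
    other end. *)
Lemma iter_derive_rcons {V W} (vs : seq V) v (f : V -> W) :
  iter_derive (rcons vs v) f = iter_derive vs (fun x => 'D_v f x).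
Proof. by elim: vs => //= u vs ->. Qed.

Lemma open_eq_iter_derive {V W} {U : set V} {f g : V -> W} vs : open U ->
  (forall z, U z -> f z = g z) ->
  forall x, U x -> iter_derive vs f x = iter_derive vs g x.
Proof.
move=> Uo fg; elim: vs => //= v vs IH x Ux.
exact: (open_eq_derive v Uo IH Ux).
Qed.

Lemma smooth_on_derive {V W} {U : set V} {f : V -> W} v :
  smooth_on U f -> smooth_on U (fun x => 'D_v f x).
Proof. by move=> fs vs x Ux; rewrite -iter_derive_rcons; exact: fs. Qed.

(** Induction on the number of directions. By the Leibniz rule the innermost derivative of [f g] is
    [f Dg + Df g], a sum of two products of smooth functions with one derivative fewer left to
    take. *)
Lemma smooth_onM {V} {U : set V} {f g : V -> R} : open U ->
  smooth_on U f -> smooth_on U g -> smooth_on U (fun x => f x * g x).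
Proof.
move=> Uo fs gs.
(* Differentiability is assumed only up to the length of [vs], because the induction below supplies
   it for the two Leibniz terms only up to that length. *)
have add_iter (vs : seq V) (h k : V -> R) :
    (forall us x, (size us <= size vs)%N -> U x ->
       differentiable (iter_derive us h) x /\ differentiable (iter_derive us k) x) ->
    forall x, U x -> iter_derive vs (fun z => h z + k z) x =
      iter_derive vs h x + iter_derive vs k x.
  elim: vs => //= v vs IH hk x Ux.
  rewrite (open_eq_derive v Uo (IH _) Ux); last first.
    by move=> us z sz Uz; apply: hk => //; rewrite (leq_trans sz).
  have [dh dk] := hk vs x (leqnSn _) Ux.
  by rewrite deriveD//; exact: diff_derivable.
(* Both functions are generalised: the induction hypothesis is applied to [(f, Dg)] and to
   [(Df, g)]. *)
suff main n : forall (f g : V -> R), smooth_on U f -> smooth_on U g ->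
    forall (vs : seq V) x, (size vs <= n)%N -> U x ->
    differentiable (iter_derive vs (fun z => f z * g z)) x.
  by move=> vs x Ux; apply: (main (size vs)).
elim: n => [|n IH] {fs gs}f {}g fs gs vs x.
  by case: vs => //= _ Ux; apply: differentiableM; [exact: (fs [::])|exact: (gs [::])].
case/lastP: vs => [|vs v]; first by move=> _ Ux; apply: IH.
rewrite size_rcons ltnS iter_derive_rcons => sz Ux.
have DM z : U z -> 'D_v (fun z => f z * g z) z = f z * 'D_v g z + 'D_v f z * g z.
  move=> Uz; rewrite (mulrC ('D_v f z)) deriveM//; apply: diff_derivable.
    exact: (fs [::]).
  exact: (gs [::]).
have hk us z : (size us <= size vs)%N -> U z ->
    differentiable (iter_derive us (fun z => f z * 'D_v g z)) z /\
    differentiable (iter_derive us (fun z => 'D_v f z * g z)) z.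
  move=> szu Uz; split; apply: IH (leq_trans szu sz) Uz => //;
    exact: smooth_on_derive.
apply: (@open_eq_differentiable _ _ U (fun z =>
  iter_derive vs (fun z => f z * 'D_v g z) z +
  iter_derive vs (fun z => 'D_v f z * g z) z)) => //.
  move=> z Uz; rewrite -(add_iter _ _ _ hk z Uz).
  by apply: (open_eq_iter_derive vs Uo) Uz => {}z Uz; rewrite DM.
have [dh dk] := hk vs x (leqnn _) Ux.
exact: differentiableD.
Qed.

End Derivatives.

(** * Openness of the slit domains *)

Section Slit.
Context {R : realType}.

Lemma open_setC1 {V : normedModType R} (a : V) : open [set v : V | v != a].
Proof.
have -> : [set v : V | v != a] = ~` [set a].
  by apply/seteqP; split => v /= /eqP.
exact/closed_openC/accessible_closed_set1/hausdorff_accessible/norm_hausdorff.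
Qed.

Definition slit {n} (C : set 'rV[R]_n) : set ('rV[R]_n * 'rV[R]_n) :=
  [set z | C z.1 /\ z.2 != 0].

Lemma open_slit {n} (C : set 'rV[R]_n) : open C -> open (slit C).
Proof.
move=> Co.
have -> : slit C = (fst @^-1` C) `&` (snd @^-1` [set v | v != 0]) by [].
apply: openI; apply: open_comp => //; last exact: open_setC1.
- by move=> z _; exact: cvg_fst.
- by move=> z _; exact: cvg_snd.
Qed.

Definition pair_slit n1 n2 : set 'rV[R]_(n1 + n2) :=
  [set y | lsubmx y != 0 /\ rsubmx y != 0].

(** Openness allows identities that hold on this set to be differentiated again along the fibre,
    through [open_eq_derive]. *)
Lemma open_pair_slit n1 n2 : open (@pair_slit n1 n2).
Proof.
have -> : @pair_slit n1 n2 =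
  (lsubmx @^-1` [set v | v != 0]) `&` (rsubmx @^-1` [set v | v != 0]) by [].
apply: openI; apply: open_comp; try exact: open_setC1; move=> z _.
- exact/differentiable_continuous/differentiable_lsubmx.
- exact/differentiable_continuous/differentiable_rsubmx.
Qed.

End Slit.

(** * Partial derivatives in the base point and in the fibre vector *)

Section SmoothTwoPoint.
Context {R : realType} {n : nat} {C : set 'rV[R]_n} {S : 'rV[R]_n -> 'rV[R]_n -> R}.
Hypothesis S_smooth : smooth_on (slit C) (fun z => S z.1 z.2).
Implicit Types x y u v w : 'rV[R]_n.

Let affine1 x y v h : (h *: v + x, y) = h *: (v, 0) + (x, y) :> _ * 'rV[R]_n.
Proof. by rewrite /GRing.scale/= /GRing.add/= /add_pair/scale_pair/= scaler0 add0r. Qed.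

Let affine2 x y v h : (x, h *: v + y) = h *: (0, v) + (x, y) :> 'rV[R]_n * _.
Proof. by rewrite /GRing.scale/= /GRing.add/= /add_pair/scale_pair/= scaler0 add0r. Qed.

Lemma derive_fst_pair (T : 'rV[R]_n * 'rV[R]_n -> R) x y v :
  'D_v (fun x => T (x, y)) x = 'D_(v, 0) T (x, y).
Proof. exact: (derive_affine (affine1 x y v) T). Qed.

Lemma derive_snd_pair (T : 'rV[R]_n * 'rV[R]_n -> R) x y v :
  'D_v (fun y => T (x, y)) y = 'D_(0, v) T (x, y).
Proof. exact: (derive_affine (affine2 x y v) T). Qed.

Lemma derivable_fst_pair (T : 'rV[R]_n * 'rV[R]_n -> R) x y v :
  derivable T (x, y) (v, 0) -> derivable (fun x => T (x, y)) x v.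
Proof. exact: (iffRL (derivable_affine (affine1 x y v) T)). Qed.

Lemma smooth_derivable_fst x y v : slit C (x, y) -> derivable (S^~ y) x v.
Proof.
move=> xy.
have dS : derivable (fun z => S z.1 z.2) (x, y) (v, 0).
  by apply: diff_derivable; exact: (S_smooth [::]).
exact: (derivable_fst_pair (T := fun z => S z.1 z.2) dS).
Qed.

Lemma derivable_snd_pair (T : 'rV[R]_n * 'rV[R]_n -> R) x y v :
  derivable T (x, y) (0, v) -> derivable (fun y => T (x, y)) y v.
Proof. exact: (iffRL (derivable_affine (affine2 x y v) T)). Qed.

Lemma smooth_derivable_snd x y v : slit C (x, y) -> derivable (S x) y v.
Proof.
move=> xy.
have dS : derivable (fun z => S z.1 z.2) (x, y) (0, v).
  by apply: diff_derivable; exact: (S_smooth [::]).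
exact: (derivable_snd_pair (T := fun z => S z.1 z.2) dS).
Qed.

(** A partial derivative is a directional derivative on the product space, along [(v, 0)] or
    [(0, v)], so it is smooth again and can be differentiated further. *)
Lemma smooth_on_derive_fst v :
  smooth_on (slit C) (fun z => 'D_v (S^~ z.2) z.1).
Proof.
have -> : (fun z => 'D_v (S^~ z.2) z.1) = (fun z => 'D_(v, 0) (fun z => S z.1 z.2) z).
  by apply/funext => -[x y]; rewrite -derive_fst_pair.
exact: smooth_on_derive.
Qed.

Lemma smooth_on_derive_snd v :
  smooth_on (slit C) (fun z => 'D_v (S z.1) z.2).
Proof.
have -> : (fun z => 'D_v (S z.1) z.2) = (fun z => 'D_(0, v) (fun z => S z.1 z.2) z).
  by apply/funext => -[x y]; rewrite -derive_snd_pair.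
exact: smooth_on_derive.
Qed.

End SmoothTwoPoint.

(** * Functions of one block of coordinates *)

Section SplitSums.
Context {R : realType} {n1 n2 : nat}.

Lemma lsubmx_deltal i : lsubmx (delta_mx 0 (lshift n2 i) : 'rV[R]_(n1 + n2)) =
  delta_mx 0 i :> 'rV[R]_n1.
Proof. by apply/rowP => j; rewrite !mxE /= (inj_eq (@lshift_inj _ _)). Qed.

Lemma rsubmx_deltal i : rsubmx (delta_mx 0 (lshift n2 i) : 'rV[R]_(n1 + n2)) = 0 :> 'rV[R]_n2.
Proof. by apply/rowP => j; rewrite !mxE /= eq_rlshift. Qed.

Lemma lsubmx_deltar i : lsubmx (delta_mx 0 (rshift n1 i) : 'rV[R]_(n1 + n2)) = 0 :> 'rV[R]_n1.
Proof. by apply/rowP => j; rewrite !mxE /= eq_lrshift. Qed.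

Lemma rsubmx_deltar i : rsubmx (delta_mx 0 (rshift n1 i) : 'rV[R]_(n1 + n2)) =
  delta_mx 0 i :> 'rV[R]_n2.
Proof. by apply/rowP => j; rewrite !mxE /= (inj_eq (@rshift_inj _ _)). Qed.

Lemma is_derive_lsubmx (f : 'rV[R]_n1 -> R) (x v : 'rV[R]_(n1 + n2)) :
  derivable f (lsubmx x) (lsubmx v) ->
  is_derive x v (fun z => f (lsubmx z)) ('D_(lsubmx v) f (lsubmx x)).
Proof. by apply: is_derive_affine => h; rewrite linearP. Qed.

Lemma is_derive_rsubmx (f : 'rV[R]_n2 -> R) (x v : 'rV[R]_(n1 + n2)) :
  derivable f (rsubmx x) (rsubmx v) ->
  is_derive x v (fun z => f (rsubmx z)) ('D_(rsubmx v) f (rsubmx x)).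
Proof. by apply: is_derive_affine => h; rewrite linearP. Qed.

Lemma derive_split (k1 k2 : R) (f1 : 'rV[R]_n1 -> R) (f2 : 'rV[R]_n2 -> R)
    (x v : 'rV[R]_(n1 + n2)) :
  derivable f1 (lsubmx x) (lsubmx v) -> derivable f2 (rsubmx x) (rsubmx v) ->
  'D_v (fun z => k1 * f1 (lsubmx z) + k2 * f2 (rsubmx z)) x =
  k1 * 'D_(lsubmx v) f1 (lsubmx x) + k2 * 'D_(rsubmx v) f2 (rsubmx x).
Proof.
move=> df1 df2.
have D := is_derive_lincomb k1 k2 (is_derive_lsubmx df1) (is_derive_rsubmx df2).
exact: (@derive_val _ _ _ _ _ _ _ D).
Qed.

End SplitSums.

(** * Derivatives of the warped energy *)

Section WarpedSum.
Context {R : realType} {n1 n2 : nat}.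
Context {C1 : set 'rV[R]_n1} {C2 : set 'rV[R]_n2}.
Variables (S1 : 'rV[R]_n1 -> 'rV[R]_n1 -> R) (S2 : 'rV[R]_n2 -> 'rV[R]_n2 -> R).
Variables (w1 : 'rV[R]_n1 -> R) (w2 : 'rV[R]_n2 -> R).
Hypothesis S1_smooth : smooth_on (slit C1) (fun z => S1 z.1 z.2).
Hypothesis S2_smooth : smooth_on (slit C2) (fun z => S2 z.1 z.2).
Hypothesis w1_diff : forall x, C1 x -> differentiable w1 x.
Hypothesis w2_diff : forall x, C2 x -> differentiable w2 x.
Implicit Types x y u v w : 'rV[R]_(n1 + n2).

(** This is the square of the doubly warped metric in a product chart when [S1], [S2] are the
    squares of the two metrics and [w1], [w2] those of the warping functions. *)
Definition warped_sum x y : R :=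
  w2 (rsubmx x) * S1 (lsubmx x) (lsubmx y) + w1 (lsubmx x) * S2 (rsubmx x) (rsubmx y).

Section Point.
Variable x : 'rV[R]_(n1 + n2).
Hypotheses (C1x : C1 (lsubmx x)) (C2x : C2 (rsubmx x)).

Lemma derive_warped_sum_base y v : pair_slit y ->
  'D_v (warped_sum^~ y) x =
  (w2 (rsubmx x) * 'D_(lsubmx v) (S1^~ (lsubmx y)) (lsubmx x)
   + 'D_(rsubmx v) w2 (rsubmx x) * S1 (lsubmx x) (lsubmx y))
  + ('D_(lsubmx v) w1 (lsubmx x) * S2 (rsubmx x) (rsubmx y)
     + w1 (lsubmx x) * 'D_(rsubmx v) (S2^~ (rsubmx y)) (rsubmx x)).
Proof.
move=> [ly ry].
have D1 := @is_derive_lsubmx _ _ n2 (S1^~ (lsubmx y)) x v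
  (smooth_derivable_fst S1_smooth (conj C1x ly)).
have D2 := @is_derive_rsubmx _ n1 _ (S2^~ (rsubmx y)) x v
  (smooth_derivable_fst S2_smooth (conj C2x ry)).
have E1 := @is_derive_lsubmx _ _ n2 w1 x v (diff_derivable (w1_diff C1x)).
have E2 := @is_derive_rsubmx _ n1 _ w2 x v (diff_derivable (w2_diff C2x)).
have D := is_deriveD (is_derive_mul E2 D1) (is_derive_mul E1 D2).
rewrite (addrC ('D_(lsubmx v) w1 _ * _)).
exact: (@derive_val _ _ _ _ _ _ _ D).
Qed.

Lemma derive_warped_sum_fibre y v : pair_slit y ->
  'D_v (warped_sum x) y =
  w2 (rsubmx x) * 'D_(lsubmx v) (S1 (lsubmx x)) (lsubmx y)
  + w1 (lsubmx x) * 'D_(rsubmx v) (S2 (rsubmx x)) (rsubmx y).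
Proof.
move=> [ly ry]; apply: derive_split.
  exact: (smooth_derivable_snd S1_smooth (conj C1x ly)).
exact: (smooth_derivable_snd S2_smooth (conj C2x ry)).
Qed.

Lemma derive2_warped_sum_fibre y u v : pair_slit y ->
  'D_u (fun y => 'D_v (warped_sum x) y) y =
  w2 (rsubmx x) * 'D_(lsubmx u) (fun z => 'D_(lsubmx v) (S1 (lsubmx x)) z) (lsubmx y)
  + w1 (lsubmx x) * 'D_(rsubmx u) (fun z => 'D_(rsubmx v) (S2 (rsubmx x)) z) (rsubmx y).
Proof.
move=> sy; rewrite (open_eq_derive u (@open_pair_slit R n1 n2)
  (fun z => derive_warped_sum_fibre v) sy).
case: sy => ly ry; apply: derive_split.
  exact: (smooth_derivable_snd
    (S := fun a => 'D_(lsubmx v) (S1 a)) (smooth_on_derive_snd S1_smooth _) (conj C1x ly)).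
exact: (smooth_derivable_snd
    (S := fun a => 'D_(rsubmx v) (S2 a)) (smooth_on_derive_snd S2_smooth _) (conj C2x ry)).
Qed.

(** The formula for the base derivative holds on the open set [pair_slit] and is differentiated in
    [y] term by term, the weights being constant along the fibre. The two terms with a derivative of
    a weight are the coupling between the factors. *)
Lemma derive_mixed_warped_sum y u v : pair_slit y ->
  'D_u (fun y => 'D_v (warped_sum^~ y) x) y =
  (w2 (rsubmx x) * 'D_(lsubmx u)
      (fun z => 'D_(lsubmx v) (S1^~ z) (lsubmx x)) (lsubmx y)
   + 'D_(rsubmx v) w2 (rsubmx x) * 'D_(lsubmx u) (S1 (lsubmx x)) (lsubmx y))
  + ('D_(lsubmx v) w1 (lsubmx x) * 'D_(rsubmx u) (S2 (rsubmx x)) (rsubmx y)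
     + w1 (lsubmx x) * 'D_(rsubmx u)
      (fun z => 'D_(rsubmx v) (S2^~ z) (rsubmx x)) (rsubmx y)).
Proof.
move=> sy; rewrite (open_eq_derive u (@open_pair_slit R n1 n2)
  (fun z => derive_warped_sum_base v) sy).
case: sy => ly ry.
have D1 := smooth_derivable_snd S1_smooth (conj C1x ly) (v := lsubmx u).
have D2 := smooth_derivable_snd S2_smooth (conj C2x ry) (v := rsubmx u).
have E1 := smooth_derivable_snd (S := fun a b => 'D_(lsubmx v) (S1^~ b) a)
  (smooth_on_derive_fst S1_smooth (lsubmx v))
  (conj C1x ly) (v := lsubmx u).
have E2 := smooth_derivable_snd (S := fun a b => 'D_(rsubmx v) (S2^~ b) a)
  (smooth_on_derive_fst S2_smooth (rsubmx v))
  (conj C2x ry) (v := rsubmx u).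
have I1 := is_derive_lsubmx D1; have I2 := is_derive_rsubmx D2.
have J1 := is_derive_lsubmx E1; have J2 := is_derive_rsubmx E2.
have D := is_deriveD 
  (is_derive_lincomb (w2 (rsubmx x)) ('D_(rsubmx v) w2 (rsubmx x)) J1 I1)
  (is_derive_lincomb ('D_(lsubmx v) w1 (lsubmx x)) (w1 (lsubmx x)) I2 J2).
exact: (@derive_val _ _ _ _ _ _ _ D).
Qed.

End Point.
End WarpedSum.

(** Derivatives along [0] arise because a coordinate direction of one factor projects to [0] in the
    other. *)
Lemma derive_derive0 (R : realType) (V : normedModType R) (f : V -> R) u x :
  'D_u (fun z => 'D_0 f z) x = 0.
Proof.
have -> : (fun z => 'D_0 f z) = cst 0 by apply/funext => z; rewrite derive0.
exact: derive_cst.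
Qed.

Lemma derive_derive0_base (R : realType) (V V' : normedModType R) (f : V -> V' -> R) u x y :
  'D_u (fun z => 'D_0 (f^~ z) x) y = 0.
Proof.
have -> : (fun z => 'D_0 (f^~ z) x) = cst 0 by apply/funext => z; rewrite derive0.
exact: derive_cst.
Qed.

(** * Third derivatives of an affine function plus a multiple of [S] *)

Section AffinePerturbation.
Context {R : realType} {n : nat} {C : set 'rV[R]_n} {S : 'rV[R]_n -> 'rV[R]_n -> R}.
Hypothesis S_smooth : smooth_on (slit C) (fun z => S z.1 z.2).

(** One derivative turns the affine part into a constant and the next one removes it. All identities
    are differentiated on the open set of nonzero vectors. *)
Lemma derive3_affine_add (x : 'rV[R]_n) (f : 'rV[R]_n -> R) a (b : 'I_n -> R) q :
  C x -> (forall v, v != 0 -> f v = a + \sum_i b i * v 0 i + q * S x v) ->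
  forall u1 u2 u3 v, v != 0 ->
  'D_u1 (fun v => 'D_u2 (fun v => 'D_u3 f v) v) v =
  q * 'D_u1 (fun v => 'D_u2 (fun v => 'D_u3 (S x) v) v) v.
Proof.
move=> Cx fE u1 u2 u3 v v0.
have cstE (g h : 'rV[R]_n -> R) c w : (forall z, z != 0 -> g z = c + q * h z) ->
    (forall z, z != 0 -> derivable h z w) ->
    forall z, z != 0 -> 'D_w g z = q * 'D_w h z.
  move=> gE dh z z0; rewrite (open_eq_derive w (@open_setC1 _ _ 0) gE z0).
  have D := is_deriveD (is_derive_cst c z w) (is_deriveZ q (derivableP (dh z z0))).
  rewrite -[RHS]add0r; exact: (@derive_val _ _ _ _ _ _ _ D).
have linE w z : z != 0 -> 'D_w f z = (\sum_i b i * w 0 i) + q * 'D_w (S x) z.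
  move=> z0; rewrite (open_eq_derive w (@open_setC1 _ _ 0) fE z0).
  (* The linear form [g] satisfies the substitution rule for affine maps; composed with the
     identity, it gets the derivative [g w] along [w]. *)
  pose g (z : 'rV[R]_n) := \sum_i b i * z 0 i.
  have gE (h : R) : g (h *: w + z) = h *: g w + g z.
    rewrite /g scaler_sumr -big_split /=; apply: eq_bigr => i _.
    by rewrite !mxE /GRing.scale/=; ring.
  have := is_derive_affine gE (@derivable_id _ _ (g z) (g w)); rewrite derive_id => Dg.
  have DS := derivableP (smooth_derivable_snd S_smooth (v := w) (conj Cx z0)).
  have D := is_deriveD (is_deriveD (is_derive_cst a z w) Dg) (is_deriveZ q DS).
  rewrite -[in RHS](add0r (\sum_i _)).
  exact: (@derive_val _ _ _ _ _ _ _ D).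
(* The constant term is [0] for the outermost derivative and the value of the linear form at [u3]
   for the middle one. *)
apply: (cstE _ _ 0) => // [z z0|z z0]; last first.
  exact: (smooth_derivable_snd (S := fun a => 'D_u2 ('D_u3 (S a)))
    (smooth_on_derive_snd (S := fun a => 'D_u3 (S a)) (smooth_on_derive_snd S_smooth _) _)
    (conj Cx z0)).
rewrite add0r; apply: (cstE _ _ (\sum_i b i * u3 0 i)) => // {z z0} z z0.
  exact: linE.
exact: (smooth_derivable_snd (S := fun a => 'D_u3 (S a))
  (smooth_on_derive_snd S_smooth _) (conj Cx z0)).
Qed.

End AffinePerturbation.

(** * Third derivatives along projected coordinate directions *)

Section UnitOrZero.
Context {R : realType} {n : nat}.

(** These are the possible projections of a basis vector of the product to one block. *)
Definition unit_or_zero (u : 'rV[R]_n) := (exists i, u = delta_mx 0 i) \/ u = 0.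

Lemma derive3_unit_or_zero (f : 'rV[R]_n -> R) y u v w :
  (forall i j k, 'D_(delta_mx 0 i) (fun y => 'D_(delta_mx 0 j)
    (fun y => 'D_(delta_mx 0 k) f y) y) y = 0) ->
  unit_or_zero u -> unit_or_zero v -> unit_or_zero w ->
  'D_u (fun y => 'D_v (fun y => 'D_w f y) y) y = 0.
Proof.
have cst0 (a : 'rV[R]_n) : (fun y => 'D_a (fun=> 0 : R) y) = (fun=> 0).
  by apply/funext => z; exact: derive_cst.
have dir0 (g : 'rV[R]_n -> R) : (fun y => 'D_0 g y) = (fun=> 0).
  by apply/funext => z; exact: derive0.
move=> f0 uP vP [[k ->]|->]; last by rewrite (dir0 f) cst0; exact: derive_cst.
case: vP => [[j ->]|->]; last first.
  by rewrite (dir0 (fun y => 'D_(delta_mx 0 k) f y)); exact: derive_cst.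
case: uP => [[i ->]|->]; [exact: f0|exact: derive0].
Qed.

End UnitOrZero.

(** * Slices of the fibre with one component frozen *)

Section FibreSlices.
Context {R : realType} {n1 n2 : nat}.
Implicit Types G : 'rV[R]_(n1 + n2) -> R.

Lemma derive_row_mx_r G y1 v i :
  'D_(delta_mx 0 (rshift n1 i)) G (row_mx y1 v) =
  'D_(delta_mx 0 i) (fun v => G (row_mx y1 v)) v.
Proof.
rewrite delta_mx_rshift; apply/esym/(derive_affine (phi := row_mx y1)) => h.
by rewrite scale_row_mx scaler0 add_row_mx add0r.
Qed.

Lemma derive_row_mx_l G v y2 i :
  'D_(delta_mx 0 (lshift n2 i)) G (row_mx v y2) =
  'D_(delta_mx 0 i) (fun v => G (row_mx v y2)) v.
Proof.
rewrite delta_mx_lshift; apply/esym/(derive_affine (phi := row_mx^~ y2)) => h.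
by rewrite scale_row_mx scaler0 add_row_mx add0r.
Qed.

(** With [y1] frozen, a direction of the second factor moves [v] alone. Each derivative is
    transferred as an identity between functions of [v], so that the next one can be taken. *)
Lemma derive3_row_mx_r G y1 v i j k :
  'D_(delta_mx 0 (rshift n1 i)) (fun y => 'D_(delta_mx 0 (rshift n1 j))
    (fun y => 'D_(delta_mx 0 (rshift n1 k)) G y) y) (row_mx y1 v) =
  'D_(delta_mx 0 i) (fun v => 'D_(delta_mx 0 j) (fun v => 'D_(delta_mx 0 k)
    (fun v => G (row_mx y1 v)) v) v) v.
Proof.
have E1 : (fun v => 'D_(delta_mx 0 (rshift n1 k)) G (row_mx y1 v)) =
    (fun v => 'D_(delta_mx 0 k) (fun v => G (row_mx y1 v)) v).
  by apply/funext => u; exact: derive_row_mx_r.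
have E2 : (fun v => 'D_(delta_mx 0 (rshift n1 j))
      (fun y => 'D_(delta_mx 0 (rshift n1 k)) G y) (row_mx y1 v)) =
    (fun v => 'D_(delta_mx 0 j) (fun v => 'D_(delta_mx 0 k) (fun v => G (row_mx y1 v)) v) v).
  apply/funext => u; rewrite -E1.
  exact: (derive_row_mx_r (fun y => 'D_(delta_mx 0 (rshift n1 k)) G y)).
rewrite -E2; exact: (derive_row_mx_r (fun y => 'D_(delta_mx 0 (rshift n1 j))
  (fun y => 'D_(delta_mx 0 (rshift n1 k)) G y) y)).
Qed.

Lemma derive3_row_mx_l G v y2 i j k :
  'D_(delta_mx 0 (lshift n2 i)) (fun y => 'D_(delta_mx 0 (lshift n2 j))
    (fun y => 'D_(delta_mx 0 (lshift n2 k)) G y) y) (row_mx v y2) =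
  'D_(delta_mx 0 i) (fun v => 'D_(delta_mx 0 j) (fun v => 'D_(delta_mx 0 k)
    (fun v => G (row_mx v y2)) v) v) v.
Proof.
have E1 : (fun v => 'D_(delta_mx 0 (lshift n2 k)) G (row_mx v y2)) =
    (fun v => 'D_(delta_mx 0 k) (fun v => G (row_mx v y2)) v).
  by apply/funext => u; exact: derive_row_mx_l.
have E2 : (fun v => 'D_(delta_mx 0 (lshift n2 j))
      (fun y => 'D_(delta_mx 0 (lshift n2 k)) G y) (row_mx v y2)) =
    (fun v => 'D_(delta_mx 0 j) (fun v => 'D_(delta_mx 0 k) (fun v => G (row_mx v y2)) v) v).
  apply/funext => u; rewrite -E1.
  exact: (derive_row_mx_l (fun y => 'D_(delta_mx 0 (lshift n2 k)) G y)).
rewrite -E2; exact: (derive_row_mx_l (fun y => 'D_(delta_mx 0 (lshift n2 j))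
  (fun y => 'D_(delta_mx 0 (lshift n2 k)) G y) y)).
Qed.

(** Brings a spray coefficient to the form required by [derive3_affine_add]. Here [h] is a row of
    the inverse metric of one factor, while [v] and [s] are the fibre vector and the energy of the
    other. *)
Lemma sum_affine_split n m (h A N : 'I_n -> R) (B : 'I_n -> 'I_m -> R) (v : 'rV[R]_m) s :
  4^-1 * \sum_j h j * (A j + \sum_k B j k * v 0 k - N j * s) =
  4^-1 * (\sum_j h j * A j) + \sum_k (4^-1 * \sum_j h j * B j k) * v 0 k
  + (- 4^-1 * \sum_j h j * N j) * s.
Proof.
have -> : \sum_j h j * (A j + \sum_k B j k * v 0 k - N j * s) =
    \sum_j h j * A j + \sum_k (\sum_j h j * B j k) * v 0 k - (\sum_j h j * N j) * s.
  under [X in _ + X - _]eq_bigr do rewrite mulr_suml.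
  rewrite exchange_big /= mulr_suml -big_split /= -sumrB.
  apply: eq_bigr => j _; rewrite mulrBr mulrDr mulrA mulr_sumr.
  by congr (_ + _ - _); apply: eq_bigr => k _; rewrite mulrA.
under [X in _ = _ + X + _]eq_bigr do rewrite -mulrA.
by rewrite -mulr_sumr; ring.
Qed.

End FibreSlices.

(** * Metric tensor, spray and curvatures of the warped product *)

Section WarpedSpray.
Context {R : realType} {n1 n2 : nat}.
Context {C1 : set 'rV[R]_n1} {C2 : set 'rV[R]_n2}.
Variables (F : 'rV[R]_(n1 + n2) -> 'rV[R]_(n1 + n2) -> R).
Variables (F1 : 'rV[R]_n1 -> 'rV[R]_n1 -> R) (F2 : 'rV[R]_n2 -> 'rV[R]_n2 -> R).
Variables (w1 : 'rV[R]_n1 -> R) (w2 : 'rV[R]_n2 -> R).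
Let S1 := sqr_metric F1.
Let S2 := sqr_metric F2.
Hypothesis FE : sqr_metric F = warped_sum S1 S2 w1 w2.
Hypothesis S1_smooth : smooth_on (slit C1) (fun z => S1 z.1 z.2).
Hypothesis S2_smooth : smooth_on (slit C2) (fun z => S2 z.1 z.2).
Hypothesis w1_diff : forall x, C1 x -> differentiable w1 x.
Hypothesis w2_diff : forall x, C2 x -> differentiable w2 x.
Hypothesis w1_neq0 : forall x, C1 x -> w1 x != 0.
Hypothesis w2_neq0 : forall x, C2 x -> w2 x != 0.
Hypothesis metric1_unit : forall x y, C1 x -> y != 0 -> metric_tensor F1 x y \in unitmx.
Hypothesis metric2_unit : forall x y, C2 x -> y != 0 -> metric_tensor F2 x y \in unitmx.

Let deltaE := (@lsubmx_deltal R n1 n2, @rsubmx_deltal R n1 n2,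
  @lsubmx_deltar R n1 n2, @rsubmx_deltar R n1 n2).

Section Point.
Variable x : 'rV[R]_(n1 + n2).
Hypotheses (C1x : C1 (lsubmx x)) (C2x : C2 (rsubmx x)).

(** The mixed blocks vanish because each summand of the energy involves the fibre vector of one
    factor only. *)
Lemma metric_tensor_warped y : pair_slit y ->
  metric_tensor F x y = block_mx (w2 (rsubmx x) *: metric_tensor F1 (lsubmx x) (lsubmx y))
    0 0 (w1 (lsubmx x) *: metric_tensor F2 (rsubmx x) (rsubmx y)).
Proof.
move=> sy; apply/matrixP => a b; rewrite mxE /dy FE.
rewrite (derive2_warped_sum_fibre w1 w2 S1_smooth S2_smooth C1x C2x _ _ sy).
case: (split_ordP a) => i ->; case: (split_ordP b) => j ->;
  rewrite ?block_mxEul ?block_mxEur ?block_mxEdl ?block_mxEdr mxE !deltaE.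
- by rewrite (@derive0 _ 'rV[R]_n2) mulr0 addr0 mxE mulrCA.
- by rewrite (@derive0 _ 'rV[R]_n2) derive_derive0 !mulr0 addr0 mulr0.
- by rewrite (@derive0 _ 'rV[R]_n1) derive_derive0 !mulr0 addr0 mulr0.
- by rewrite (@derive0 _ 'rV[R]_n1) mulr0 add0r mxE mulrCA.
Qed.

Lemma invmx_metric_tensor_warped y : pair_slit y ->
  invmx (metric_tensor F x y) =
  block_mx (invmx (w2 (rsubmx x) *: metric_tensor F1 (lsubmx x) (lsubmx y)))
    0 0 (invmx (w1 (lsubmx x) *: metric_tensor F2 (rsubmx x) (rsubmx y))).
Proof.
move=> sy; rewrite metric_tensor_warped // invmx_block_diag //.
case: sy => ly ry; rewrite block_diag_mx_unit.
by rewrite !unitmxZ ?unitfE ?w1_neq0 ?w2_neq0 // metric1_unit // metric2_unit.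
Qed.

(** The inverse metric is block diagonal, so only indices of the first factor contribute. As a
    function of [rsubmx y], the first term in the bracket is constant, the second is linear, and the
    last is a multiple of [S2]. *)
Lemma spray_coef_warped_l i y : pair_slit y ->
  spray_coef F (lshift n2 i) x y =
  4^-1 * \sum_j invmx (w2 (rsubmx x) *: metric_tensor F1 (lsubmx x) (lsubmx y)) i j *
    (w2 (rsubmx x) * (\sum_k dy j (dx k S1) (lsubmx x) (lsubmx y) * lsubmx y 0 k
      - dx j S1 (lsubmx x) (lsubmx y))
    + \sum_k 'D_(delta_mx 0 k) w2 (rsubmx x) * dy j S1 (lsubmx x) (lsubmx y) * rsubmx y 0 k
    - 'D_(delta_mx 0 j) w1 (lsubmx x) * S2 (rsubmx x) (rsubmx y)).
Proof.
move=> sy; rewrite /spray_coef invmx_metric_tensor_warped // big_split_ord /=.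
rewrite [X in _ + X]big1 ?addr0; last first.
  by move=> j _; rewrite block_mxEur mxE mul0r.
congr (_ * _); apply: eq_bigr => j _; rewrite block_mxEul; congr (_ * _).
rewrite big_split_ord /= /dy /dx FE.
rewrite (derive_warped_sum_base S1_smooth S2_smooth w1_diff w2_diff C1x C2x _ sy).
have mixE c := derive_mixed_warped_sum S1_smooth S2_smooth w1_diff w2_diff C1x C2x
  (delta_mx 0 (lshift n2 j)) (delta_mx 0 c) sy.
have yl k : y 0 (lshift n2 k) = lsubmx y 0 k by rewrite mxE.
have yr k : y 0 (rshift n1 k) = rsubmx y 0 k by rewrite mxE.
(* Along base directions of the first factor only the mixed derivative of [S1] survives. *)
under eq_bigr do rewrite mixE !deltaE !(@derive0 _ 'rV[R]_n2) mul0r !mulr0 !addr0 yl.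
(* Along base directions of the second factor only the derivative of [w2] times a fibre derivative
   of [S1] survives. *)
under [X in _ + X - _]eq_bigr do rewrite mixE !deltaE (@derive0 _ 'rV[R]_n1)
  !(@derive0 _ 'rV[R]_n2) derive_derive0_base !mulr0 !addr0 add0r yr.
rewrite !deltaE !(@derive0 _ 'rV[R]_n2) mul0r mulr0 !addr0 mulrBr mulr_sumr.
under eq_bigr do rewrite -mulrA.
by rewrite opprD !addrA; congr (_ - _); exact: addrAC.
Qed.

Lemma spray_coef_warped_r i y : pair_slit y ->
  spray_coef F (rshift n1 i) x y =
  4^-1 * \sum_j invmx (w1 (lsubmx x) *: metric_tensor F2 (rsubmx x) (rsubmx y)) i j *
    (w1 (lsubmx x) * (\sum_k dy j (dx k S2) (rsubmx x) (rsubmx y) * rsubmx y 0 k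
      - dx j S2 (rsubmx x) (rsubmx y))
    + \sum_k 'D_(delta_mx 0 k) w1 (lsubmx x) * dy j S2 (rsubmx x) (rsubmx y) * lsubmx y 0 k
    - 'D_(delta_mx 0 j) w2 (rsubmx x) * S1 (lsubmx x) (lsubmx y)).
Proof.
move=> sy; rewrite /spray_coef invmx_metric_tensor_warped // big_split_ord /=.
rewrite [X in X + _]big1 ?add0r; last first.
  by move=> j _; rewrite block_mxEdl mxE mul0r.
congr (_ * _); apply: eq_bigr => j _; rewrite block_mxEdr; congr (_ * _).
rewrite big_split_ord /= /dy /dx FE.
rewrite (derive_warped_sum_base S1_smooth S2_smooth w1_diff w2_diff C1x C2x _ sy).
have mixE c := derive_mixed_warped_sum S1_smooth S2_smooth w1_diff w2_diff C1x C2x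
  (delta_mx 0 (rshift n1 j)) (delta_mx 0 c) sy.
have yl k : y 0 (lshift n2 k) = lsubmx y 0 k by rewrite mxE.
have yr k : y 0 (rshift n1 k) = rsubmx y 0 k by rewrite mxE.
under eq_bigr do rewrite mixE !deltaE (@derive0 _ 'rV[R]_n2) !(@derive0 _ 'rV[R]_n1)
  derive_derive0_base !mulr0 !add0r !addr0 yl.
under [X in _ + X - _]eq_bigr do rewrite mixE !deltaE
  !(@derive0 _ 'rV[R]_n1) mul0r !mulr0 !add0r yr.
rewrite !deltaE !(@derive0 _ 'rV[R]_n1) mul0r mulr0 !add0r mulrBr mulr_sumr.
under [X in _ + X - _]eq_bigr do rewrite -mulrA.
ring.
Qed.

(** Upper index in the first factor, lower indices in the second: with [y1] fixed the spray
    coefficient is affine in [v] plus a multiple of [S2]. The multiplier is, up to a constant, a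
    component of the gradient of [w1] and does not depend on [v]. *)
Lemma berwald_curvature_warped_l y1 v i a b c : y1 != 0 -> v != 0 ->
  berwald_curvature F (rshift n1 a) (rshift n1 b) (rshift n1 c) (lshift n2 i) x (row_mx y1 v) =
  (- 4^-1 * \sum_j invmx (w2 (rsubmx x) *: metric_tensor F1 (lsubmx x) y1) i j *
    'D_(delta_mx 0 j) w1 (lsubmx x)) * dy a (dy b (dy c S2)) (rsubmx x) v.
Proof.
move=> y10 v0; rewrite /berwald_curvature /dy derive3_row_mx_r.
apply: (derive3_affine_add S2_smooth C2x) => // {}v {}v0.
rewrite spray_coef_warped_l ?row_mxKl ?row_mxKr; last by split; rewrite ?row_mxKl ?row_mxKr.
exact: sum_affine_split.
Qed.

Lemma berwald_curvature_warped_r y2 v i a b c : y2 != 0 -> v != 0 ->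
  berwald_curvature F (lshift n2 a) (lshift n2 b) (lshift n2 c) (rshift n1 i) x (row_mx v y2) =
  (- 4^-1 * \sum_j invmx (w1 (lsubmx x) *: metric_tensor F2 (rsubmx x) y2) i j *
    'D_(delta_mx 0 j) w2 (rsubmx x)) * dy a (dy b (dy c S1)) (lsubmx x) v.
Proof.
move=> y20 v0; rewrite /berwald_curvature /dy derive3_row_mx_l.
apply: (derive3_affine_add S1_smooth C1x) => // {}v {}v0.
rewrite spray_coef_warped_r ?row_mxKl ?row_mxKr; last by split; rewrite ?row_mxKl ?row_mxKr.
exact: sum_affine_split.
Qed.

(** A third fibre derivative of the energy is a combination of third derivatives of [S1] and [S2]
    along the projected directions. Each of these is a basis vector or zero, so the vanishing of the
    coordinate derivatives suffices. *)
Lemma cartan_tensor_warped y a b c : pair_slit y ->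
  (forall a b c, dy a (dy b (dy c S1)) (lsubmx x) (lsubmx y) = 0) ->
  (forall a b c, dy a (dy b (dy c S2)) (rsubmx x) (rsubmx y) = 0) ->
  cartan_tensor F a b c x y = 0.
Proof.
move=> sy S1_0 S2_0; rewrite /cartan_tensor /dy.
under eq_fun do rewrite mxE.
set e := delta_mx 0 : _ -> 'rV[R]_(n1 + n2).
have entryE z : pair_slit z -> 2^-1 * dy a (dy b (warped_sum S1 S2 w1 w2)) x z =
    (2^-1 * w2 (rsubmx x)) * 'D_(lsubmx (e a)) ('D_(lsubmx (e b)) (S1 (lsubmx x))) (lsubmx z)
    + (2^-1 * w1 (lsubmx x)) * 'D_(rsubmx (e a)) ('D_(rsubmx (e b)) (S2 (rsubmx x))) (rsubmx z).
  move=> sz; rewrite -!mulrA -mulrDr; congr (_ * _).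
  exact: (derive2_warped_sum_fibre w1 w2 S1_smooth S2_smooth C1x C2x _ _ sz).
rewrite FE (open_eq_derive _ (@open_pair_slit R n1 n2) entryE sy).
have D1 := smooth_derivable_snd (S := fun z => 'D_(lsubmx (e a)) ('D_(lsubmx (e b)) (S1 z)))
  (v := lsubmx (e c)) (smooth_on_derive_snd (S := fun z => 'D_(lsubmx (e b)) (S1 z))
    (smooth_on_derive_snd S1_smooth _) _) (conj C1x (proj1 sy)).
have D2 := smooth_derivable_snd (S := fun z => 'D_(rsubmx (e a)) ('D_(rsubmx (e b)) (S2 z)))
  (v := rsubmx (e c)) (smooth_on_derive_snd (S := fun z => 'D_(rsubmx (e b)) (S2 z))
    (smooth_on_derive_snd S2_smooth _) _) (conj C2x (proj2 sy)).
rewrite (derive_split (2^-1 * w2 (rsubmx x)) (2^-1 * w1 (lsubmx x)) D1 D2).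
have lP k : unit_or_zero (lsubmx (e k)).
  by case: (split_ordP k) => i ->; rewrite /e !deltaE; [left; exists i|right].
have rP k : unit_or_zero (rsubmx (e k)).
  by case: (split_ordP k) => i ->; rewrite /e !deltaE; [right|left; exists i].
by rewrite (derive3_unit_or_zero S1_0 (lP c) (lP a) (lP b))
  (derive3_unit_or_zero S2_0 (rP c) (rP a) (rP b)) !mulr0 addr0 mulr0.
Qed.

End Point.
End WarpedSpray.

(** * Nonconstant functions on a connected manifold *)

Section Nonconstant.
Context {R : realType} {n : nat}.

Lemma derive_eq0_coord (g : 'rV[R]_n -> R) x v : differentiable g x ->
  (forall j, 'D_(delta_mx 0 j) g x = 0) -> 'D_v g x = 0.
Proof.
move=> dg g0; rewrite deriveE // [v]row_sum_delta linear_sum big1 // => j _.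
by rewrite linearZ /= -deriveE // g0 scaler0.
Qed.

(** The mean value theorem is applied to [g] on the segment from [x] to [z], which stays in the
    ball. *)
Lemma ball_derive_eq0_const (g : 'rV[R]_n -> R) x e :
  (forall z, ball x e z -> differentiable g z) ->
  (forall z j, ball x e z -> 'D_(delta_mx 0 j) g z = 0) ->
  forall z, ball x e z -> g z = g x.
Proof.
move=> dg g0 z xz; set v := z - x.
pose phi (t : R) := t *: v + x.
have ball_phi t : t \in `[0, 1] -> ball x e (phi t).
  rewrite in_itv /= => /andP[t0 t1]; move: xz; rewrite -ball_normE /ball_ /=.
  rewrite /phi opprD addrCA subrr addr0 normrN normrZ ger0_norm // distrC -/v.
  by apply: le_lt_trans; rewrite ler_piMl.
have phiE (t h : R) : phi (h *: (1 : R) + t) = h *: v + phi t.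
  by rewrite /phi (_ : h *: 1 = h) ?scalerDl ?addrA // /GRing.scale /= mulr1.
have Dh (t : R) : t \in `[0, 1] -> is_derive t (1 : R) (fun s : R => g (phi s)) (0 : R).
  move=> /ball_phi bt; have := is_derive_affine (phiE t) (diff_derivable (dg _ bt)).
  by rewrite derive_eq0_coord // => [|j]; [exact: dg|exact: g0].
have Doo (t : R) : t \in `]0, 1[ -> is_derive t (1 : R) (fun s : R => g (phi s)) (0 : R).
  by move=> t01; apply: Dh; exact: subset_itv_oo_cc.
have hc : {within `[0, 1], continuous (fun s : R => g (phi s))}.
  apply: derivable_within_continuous => t t01.
  exact: (@ex_derive _ _ _ _ _ _ _ (Dh t t01)).
have [c _] := MVT_segment (df := fun=> 0) ler01 Doo hc.
rewrite mul0r /phi scale1r scale0r add0r subrK => /eqP; rewrite subr_eq0 => /eqP.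
exact.
Qed.

(** If every partial derivative vanished in every chart, [f] would be locally constant. Its level
    sets would then be open and closed, and connectedness would make [f] constant. *)
Lemma nonconstant_derive_neq0 (M : smooth_manifold R n) (f : M -> R) :
  smooth_function f -> ~ constant_function f ->
  exists i x j, chart_codom i x /\ 'D_(delta_mx 0 j) (f \o chart_inv i) x != 0.
Proof.
move=> fs; apply: contra_notP => nex.
have g0 i x j : chart_codom i x -> 'D_(delta_mx 0 j) (f \o chart_inv i) x = 0.
  by move=> cx; apply/eqP/negPn/negP => D0; apply: nex; exists i, x, j.
have locconst (p : M) : nbhs p [set q | f q = f p].
  set i := chart_at p; have ip := chart_at_dom p.
  have cp : chart_codom i (chart_map i p) by exists p.
  have /nbhs_ballP[e /= e0 be] : nbhs (chart_map i p) (chart_codom i).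
    by apply: open_nbhs_nbhs; split => //; exact: chart_codom_open.
  have gE : forall z, ball (chart_map i p) e z ->
      (f \o chart_inv i) z = (f \o chart_inv i) (chart_map i p).
    apply: ball_derive_eq0_const => [z /be cz|z j /be cz]; last exact: g0.
    exact: (fs i [::]).
  have : nbhs p (chart_map i @^-1` ball (chart_map i p) e).
    by apply: (chart_map_continuous ip); exact: nbhsx_ballx.
  have : nbhs p (chart_dom i).
    by apply: open_nbhs_nbhs; split => //; exact: chart_dom_open.
  apply: filterS2 => q iq bq /=.
  by have /= := gE _ bq; rewrite !chart_mapK.
(* The empty space is connected in the sense of [connected]; there [f] is vacuously constant, with
   value [0] for instance. *)
have [[p _]|M0] := pselect (exists p : M, True); last first.
  by exists 0 => p; case: M0; exists p.
exists (f p) => q.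
have levelE : [set q | f q = f p] = [set: M].
  apply: (@manifold_connected _ _ M).
  - by exists p.
  - exists [set q | f q = f p]; last by rewrite setTI.
    rewrite openE => r /= fr; apply: filterS (locconst r) => s /= ->; exact: fr.
  - exists [set q | f q = f p]; last by rewrite setTI.
    rewrite -openC openE => r /= fr; apply: filterS (locconst r) => s /= fs0 fsp.
    by apply: fr; rewrite -fs0.
have : [set: M] q by [].
by rewrite -levelE.
Qed.

End Nonconstant.

(** If [u A = 0], the quadratic form of [A] vanishes at [u], which positivity forbids unless
    [u = 0]. *)
Lemma posdef_unitmx (R : realType) n (A : 'M[R]_n) :
  (forall u : 'rV[R]_n, u != 0 -> 0 < \sum_(a < n) \sum_(b < n) A a b * u 0 a * u 0 b) ->
  A \in unitmx.
Proof.
move=> Apos; rewrite -row_free_unit; apply: inj_row_free => u uA.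
apply/eqP/negPn/negP => /Apos; suff -> : \sum_(a < n) \sum_(b < n) A a b * u 0 a * u 0 b =
  (u *m A *m u^T) 0 0 by rewrite uA mul0mx mxE ltxx.
rewrite exchange_big mxE; apply: eq_bigr => b _; rewrite !mxE mulr_suml.
by apply: eq_bigr => a _; rewrite (mulrC (A a b)).
Qed.

(** * Finsler metrics and squared warping functions in a chart *)

Section FinslerChart.
Context {R : realType} {n : nat} {M : smooth_manifold R n} {F : tangent M -> R} {f : M -> R}.
Hypotheses (F_finsler : finsler_metric F) (f_smooth : smooth_function f).
Hypothesis f_gt0 : forall p, 0 < f p.
Implicit Type i : chart_index M.

Definition sqr_weight f i (x : 'rV[R]_n) : R := f (chart_inv i x) ^+ 2.

Lemma finsler_sqr_smooth i :
  smooth_on (slit (chart_codom i)) (fun z => sqr_metric (local_expr F i) z.1 z.2).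
Proof.
have -> : (fun z => sqr_metric (local_expr F i) z.1 z.2) =
    (fun z => local_expr F i z.1 z.2 * local_expr F i z.1 z.2).
  by apply/funext => z; rewrite /sqr_metric expr2.
apply: smooth_onM; first exact/open_slit/chart_codom_open.
- exact: finsler_smooth.
- exact: finsler_smooth.
Qed.

Lemma finsler_metric_tensor_unit i x y : chart_codom i x -> y != 0 ->
  metric_tensor (local_expr F i) x y \in unitmx.
Proof. by move=> cx y0; apply: posdef_unitmx; exact: finsler_posdef. Qed.

Lemma sqr_weightE i : sqr_weight f i = (f \o chart_inv i) * (f \o chart_inv i).
Proof. by apply/funext => x; rewrite /sqr_weight expr2. Qed.

Lemma sqr_weight_differentiable i x : chart_codom i x -> differentiable (sqr_weight f i) x.
Proof. move=> cx; have df := @f_smooth i [::] x cx.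
by rewrite sqr_weightE; exact: differentiableM. Qed.

Lemma sqr_weight_neq0 i x : sqr_weight f i x != 0.
Proof. by rewrite /sqr_weight sqrf_eq0 gt_eqF. Qed.

(** The derivative of the square is [2 f Df], and [f] is positive. *)
Lemma derive_sqr_weight_neq0 i x v : chart_codom i x ->
  'D_v (f \o chart_inv i) x != 0 -> 'D_v (sqr_weight f i) x != 0.
Proof.
move=> cx D0; have df := diff_derivable (@f_smooth i [::] x cx) (v := v).
have double_neq0 (a b : R) : a != 0 -> b != 0 -> a * b + a * b != 0.
  by move=> a0 b0; rewrite -mulr2n mulrn_eq0 mulf_neq0.
by rewrite sqr_weightE deriveM //; apply: double_neq0 => //; exact/lt0r_neq0/f_gt0.
Qed.

End FinslerChart.

(** An invertible matrix maps a nonzero vector to a nonzero vector. With [H] an inverse metric and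
    [N] the differential of a weight, the sum is the multiplier in the Berwald curvature
    formulas. *)
Lemma unitmx_sum_neq0 (R : realType) n (H : 'M[R]_n) (N : 'I_n -> R) j : H \in unitmx ->
  N j != 0 -> exists i, - 4^-1 * \sum_k H i k * N k != 0.
Proof.
move=> Hu; apply: contra_neqP => nex.
have HN : H *m \col_k N k = 0.
  apply/colP => i; rewrite !mxE; under eq_bigr do rewrite mxE.
  apply/eqP/negPn/negP => HN0; apply: nex; exists i.
  by rewrite mulf_neq0 // oppr_eq0 invr_eq0 pnatr_eq0.
have /colP/(_ j) : \col_k N k = 0 by rewrite -(mulKmx Hu (\col_k N k)) HN mulmx0.
by rewrite !mxE.
Qed.

(** * Vanishing of the cubic derivatives of both energies *)

Section Product.
Context {R : realType} {n1 n2 : nat}.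
Context {M1 : smooth_manifold R n1} {M2 : smooth_manifold R n2}.
Variables (F1 : tangent M1 -> R) (F2 : tangent M2 -> R) (f1 : M1 -> R) (f2 : M2 -> R).
Hypotheses (F1_finsler : finsler_metric F1) (F2_finsler : finsler_metric F2).
Hypotheses (f1_smooth : smooth_function f1) (f2_smooth : smooth_function f2).
Hypotheses (f1_gt0 : forall p : M1, 0 < f1 p) (f2_gt0 : forall q : M2, 0 < f2 q).

Let F := doubly_warped_product F1 F2 f1 f2.

Lemma sqr_doubly_warped_product i1 i2 :
  sqr_metric (prod_local_expr F i1 i2) =
  warped_sum (sqr_metric (local_expr F1 i1)) (sqr_metric (local_expr F2 i2))
    (sqr_weight f1 i1) (sqr_weight f2 i2).
Proof.
apply/funext => x; apply/funext => y.
by rewrite /sqr_metric /prod_local_expr /F /doubly_warped_product sqr_sqrtr // addr_ge0 //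
  mulr_ge0 // sqr_ge0.
Qed.

Hypothesis berwald0 : berwald_vanishes F.

(** The Berwald curvature vanishes over every pair of base points, so [x] can be paired with a point
    [x2] where the differential of the weight is nonzero. There a suitable Berwald component is a
    nonzero multiple of the cubic derivative at [(x, y)]. *)
Lemma berwald0_cubic_l (f2_proper : ~ constant_function f2) i1 x y : chart_codom i1 x ->
  y != 0 -> forall a b c, dy a (dy b (dy c (sqr_metric (local_expr F1 i1)))) x y = 0.
Proof.
move=> cx y0 a b c.
have [i2 [x2 [j [cx2 D0]]]] := nonconstant_derive_neq0 f2_smooth f2_proper.
(* Any nonzero fibre vector over [x2] would serve; the index [j] of the nonzero partial derivative
   provides one. *)
have e0 : delta_mx 0 j != 0 :> 'rV[R]_n2.
  by apply/eqP => /rowP/(_ j)/eqP; rewrite !mxE !eqxx oner_eq0.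
have Dw := derive_sqr_weight_neq0 f2_smooth f2_gt0 cx2 D0.
pose H := invmx (sqr_weight f1 i1 x *: metric_tensor (local_expr F2 i2) x2 (delta_mx 0 j)).
have Hu : H \in unitmx.
  rewrite unitmx_inv unitmxZ ?unitfE ?sqr_weight_neq0 //.
  exact: finsler_metric_tensor_unit.
(* The upper index [i] is chosen so that the multiplier is nonzero. *)
have [i q0] := unitmx_sum_neq0 (N := fun k => 'D_(delta_mx 0 k) (sqr_weight f2 i2) x2) Hu Dw.
pose X := row_mx x x2.
have C1X : chart_codom i1 (lsubmx X) by rewrite row_mxKl.
have C2X : chart_codom i2 (rsubmx X) by rewrite row_mxKr.
have slitX : prod_slit_coord i1 i2 X (row_mx y (delta_mx 0 j)).
  by split; rewrite ?row_mxKl ?row_mxKr.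
have := berwald0 slitX (lshift n2 a) (lshift n2 b) (lshift n2 c) (rshift n1 i).
rewrite (berwald_curvature_warped_r (sqr_doubly_warped_product i1 i2)
  (finsler_sqr_smooth F1_finsler (i := i1)) (finsler_sqr_smooth F2_finsler (i := i2))
  (sqr_weight_differentiable f1_smooth (i := i1))
  (sqr_weight_differentiable f2_smooth (i := i2))
  (fun x _ => sqr_weight_neq0 f1_gt0 i1 x) (fun x _ => sqr_weight_neq0 f2_gt0 i2 x)
  (finsler_metric_tensor_unit F1_finsler (i := i1))
  (finsler_metric_tensor_unit F2_finsler (i := i2)) C1X C2X) //.
by rewrite row_mxKl row_mxKr => /eqP; rewrite mulf_eq0 (negPf q0) /= => /eqP.
Qed.

(** The same argument with the factors exchanged: [x] is paired with a point [x1] where the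
    differential of the first weight is nonzero. *)
Lemma berwald0_cubic_r (f1_proper : ~ constant_function f1) i2 x y : chart_codom i2 x ->
  y != 0 -> forall a b c, dy a (dy b (dy c (sqr_metric (local_expr F2 i2)))) x y = 0.
Proof.
move=> cx y0 a b c.
have [i1 [x1 [j [cx1 D0]]]] := nonconstant_derive_neq0 f1_smooth f1_proper.
have e0 : delta_mx 0 j != 0 :> 'rV[R]_n1.
  by apply/eqP => /rowP/(_ j)/eqP; rewrite !mxE !eqxx oner_eq0.
have Dw := derive_sqr_weight_neq0 f1_smooth f1_gt0 cx1 D0.
pose H := invmx (sqr_weight f2 i2 x *: metric_tensor (local_expr F1 i1) x1 (delta_mx 0 j)).
have Hu : H \in unitmx.
  rewrite unitmx_inv unitmxZ ?unitfE ?sqr_weight_neq0 //.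
  exact: finsler_metric_tensor_unit.
have [i q0] := unitmx_sum_neq0 (N := fun k => 'D_(delta_mx 0 k) (sqr_weight f1 i1) x1) Hu Dw.
pose X := row_mx x1 x.
have C1X : chart_codom i1 (lsubmx X) by rewrite row_mxKl.
have C2X : chart_codom i2 (rsubmx X) by rewrite row_mxKr.
have slitX : prod_slit_coord i1 i2 X (row_mx (delta_mx 0 j) y).
  by split; rewrite ?row_mxKl ?row_mxKr.
have := berwald0 slitX (rshift n1 a) (rshift n1 b) (rshift n1 c) (lshift n2 i).
rewrite (berwald_curvature_warped_l (sqr_doubly_warped_product i1 i2)
  (finsler_sqr_smooth F1_finsler (i := i1)) (finsler_sqr_smooth F2_finsler (i := i2))
  (sqr_weight_differentiable f1_smooth (i := i1))
  (sqr_weight_differentiable f2_smooth (i := i2))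
  (fun x _ => sqr_weight_neq0 f1_gt0 i1 x) (fun x _ => sqr_weight_neq0 f2_gt0 i2 x)
  (finsler_metric_tensor_unit F1_finsler (i := i1))
  (finsler_metric_tensor_unit F2_finsler (i := i2)) C1X C2X) //.
by rewrite row_mxKl row_mxKr => /eqP; rewrite mulf_eq0 (negPf q0) /= => /eqP.
Qed.

End Product.

Theorem theorem2 (R : realType) (n1 n2 : nat)
    (M1 : smooth_manifold R n1) (M2 : smooth_manifold R n2)
    (F1 : tangent M1 -> R) (F2 : tangent M2 -> R)
    (f1 : M1 -> R) (f2 : M2 -> R)
    (F1_finsler : finsler_metric F1) (F2_finsler : finsler_metric F2)
    (f1_smooth : smooth_function f1) (f2_smooth : smooth_function f2)
    (f1_gt0 : forall p : M1, 0 < f1 p) (f2_gt0 : forall q : M2, 0 < f2 q)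
    (f1_proper : ~ constant_function f1) (f2_proper : ~ constant_function f2)
    (berwald0 : berwald_vanishes (doubly_warped_product F1 F2 f1 f2)) :
  riemannian (doubly_warped_product F1 F2 f1 f2).
Proof.
move=> i1 i2 x y [cx1 cx2 ly ry] a b c.
apply: (cartan_tensor_warped (sqr_doubly_warped_product F1 F2 f1 f2 i1 i2)
  (finsler_sqr_smooth F1_finsler (i := i1)) (finsler_sqr_smooth F2_finsler (i := i2))
  cx1 cx2 _ _ _ (conj ly ry)).
- exact: (berwald0_cubic_l F1_finsler F2_finsler f1_smooth f2_smooth f1_gt0 f2_gt0 berwald0).
- exact: (berwald0_cubic_r F1_finsler F2_finsler f1_smooth f2_smooth f1_gt0 f2_gt0 berwald0).
Qed.
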